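(* Let $q,z$ be complex numbers with $0<|q|<1$, $z\neq 0$, and $z\ne q^{m}$ for every integer $m$. Then $$(1-z)(zq, z^{-1}q,q;q)_{\infty}\,g_2(z;q)=\sum_{n=0}^{\infty}\left(\sum_{m=0}^{[n/2]}(-1)^{m+n}z^{n-2m}q^{\frac{1}{2}(n^2-2m^2)+\frac{1}{2}n}+\sum_{m=1}^{[n/2]}(-1)^{m+n}z^{2m-n-1}q^{\frac{1}{2}(n^2-2m^2)+\frac{1}{2}n}\right).$$
   Context: Notation: $(a;q)_\infty=\prod_{n=0}^\infty(1-aq^n)$, $(a;q)_n=\dfrac{(a;q)_\infty}{(aq^n;q)_\infty}$ (so $(a;q)_n=\prod_{i=0}^{n-1}(1-aq^i)$ for $n\ge 0$), and $(a_1,\ldots,a_k;q)_\infty=(a_1;q)_\infty\cdots(a_k;q)_\infty$. $[x]$ denotes the integer part (floor) of $x$. Empty sums are $0$. The universal mock theta function $g_2$ is $$g_2(z;q)=\sum_{n=0}^{\infty}\frac{(-q;q)_n\,q^{\frac{1}{2}n(n+1)}}{(z;q)_{n+1}(z^{-1}q;q)_{n+1}}.$$ *)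

(* Defs.v *)
From HB Require Import structures.
From mathcomp Require Import all_boot all_order all_algebra.
From mathcomp Require Import complex.
From mathcomp Require Import all_classical all_reals all_analysis.

Set Implicit Arguments.
Unset Strict Implicit.
Unset Printing Implicit Defensive.

Import Order.TTheory GRing.Theory Num.Theory.
Import numFieldNormedType.Exports.

Local Open Scope ring_scope.
Local Open Scope classical_set_scope.

(* The library puts the norm topology on the carrier of every numFieldType;
   for complex numbers these definitions are used with K := R[i]. *)

(* (a; q)_n for n >= 0, as a product: the quotient (a; q)_oo / (a q^n; q)_oo
   would be 0 / 0 when a q^k = 1 for some k >= n. *)
Definition qpoch (K : numFieldType) (a q : K) (n : nat) : K :=
  \prod_(0 <= i < n) (1 - a * q ^+ i).

Definition qpoch_inf (K : numFieldType) (a q : K) : K :=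
  limn (fun N => qpoch a q N).

Definition g2 (K : numFieldType) (z q : K) : K :=
  limn (series (fun n =>
    qpoch (- q) q n * q ^+ (n * n.+1)./2%N /
      (qpoch z q n.+1 * qpoch (z^-1 * q) q n.+1))).

(* (n^2 - 2 m^2) / 2 + n / 2; the numerator below is even, so the Euclidean
   quotient is exact. *)
Definition qexp (n m : nat) : int :=
  ((n%:Z ^+ 2 - 2%:Z * m%:Z ^+ 2 + n%:Z) %/ 2)%Z.

Definition rhs_term (K : numFieldType) (z q : K) (n : nat) : K :=
  \sum_(0 <= m < (n./2).+1)
     (-1) ^+ (m + n)%N * z ^ (n%:Z - 2%:Z * m%:Z) * q ^ (qexp n m)
  + \sum_(1 <= m < (n./2).+1)
     (-1) ^+ (m + n)%N * z ^ (2%:Z * m%:Z - n%:Z - 1) * q ^ (qexp n m).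

(* The series of general term u converges in K, and its sum is l. *)
Definition has_sum (K : numFieldType) (u : nat -> K) (l : K) : Prop :=
  series u @ \oo --> l.

(* Main.v *)
(* Multiplied by the theta product, the partial sums of g2 become Laurent
   polynomials F_M(z).  They satisfy two exact finite relations: a telescoping one
   between z F_M(z) and F_M(1/z), and F_M(qz)(1 - q^M/z) = F_M(1/z)(1 - z q^(M+1)).
   Comparing coefficients of z^k, with the q-binomial theorem giving those of the
   finite theta product, yields c_k = (-1)^k q^(k(k+1)/2) + q^(k+1) c_(k+1) + o(1).
   The partial theta sums on the right-hand side satisfy this recurrence exactly, and
   it is a contraction on bounded sequences, so the coefficients of (q;q)_M F_M converge
   to them; a bound |c_k| <= B x^(-k) uniform in M, for every radius x > 0, then
   justifies summing over k. *)
Require Import Defs.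
From HB Require Import structures.
From mathcomp Require Import all_boot all_order all_algebra.
From mathcomp Require Import complex.
From mathcomp Require Import all_classical all_reals all_analysis.
From mathcomp Require Import ring zify.

Import Order.TTheory GRing.Theory Num.Theory.
Import numFieldNormedType.Exports.

Local Open Scope ring_scope.

Set Implicit Arguments.
Unset Strict Implicit.

(** The first relation ties c_k to c_(-1-k), the second ties c_(-1-k) to c_(k+1); eliminating
    c_(-1-k) is what produces the recurrence. It runs towards larger k with no initial value, so
    boundedness uniform in M has to select the solution. The factor (q;q)_M is there because the
    q-binomial coefficients [2M+1 choose M+1+k] of the finite theta product tend to 1/(q;q)_oo.
    Truncation turns functional equations, which would concern Laurent expansions in an annulus,
    into polynomial identities. In the code M = L + 1; the coefficient of z^k sits at index L + k,
    that of z^(-1-k) at index L - 1 - k. The analysis is carried out over an abstract field [K],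
    where limits are obtained from geometric bounds on increments. *)

Lemma half_mulnSS (n : nat) : ((n.+1 * n.+2)./2 = (n * n.+1)./2 + n.+1)%N.
Proof.
have -> : (n.+1 * n.+2 = n * n.+1 + n.+1.*2)%N by lia.
by rewrite halfD odd_double andbF add0n doubleK.
Qed.

(** In characteristic 0 the points 1, 2, 3, ... are distinct and nonzero, and give more roots than
    the degree allows. Excluding 0 lets identities involving [x^-1] be transferred to
    polynomials. *)
Lemma poly_eq_nonzero (K : numFieldType) (p r : {poly K}) :
  (forall x, x != 0 -> p.[x] = r.[x]) -> p = r.
Proof.
move=> epr; apply/eqP; rewrite -subr_eq0; apply/negPn/negP => nz.
set s := [seq i.+1%:R : K | i <- iota 0 (size (p - r))].
have : (size s < size (p - r)%R)%N.
  apply: max_poly_roots => //.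
  - apply/allP => x /mapP[i _ ->]; rewrite /root hornerD hornerN epr ?subrr //.
  - rewrite map_inj_uniq ?iota_uniq // => i j /eqP.
    by rewrite eqr_nat => /eqP[].
by rewrite size_map size_iota ltnn.
Qed.

(** * Finite q-products and the q-binomial theorem *)

Lemma qpochSr (K : numFieldType) (a q : K) (n : nat) :
  qpoch a q n.+1 = qpoch a q n * (1 - a * q ^+ n).
Proof. by rewrite /qpoch big_nat_recr. Qed.

Lemma qpoch0 (K : numFieldType) (a q : K) : qpoch a q 0 = 1.
Proof. by rewrite /qpoch big_geq. Qed.

Lemma qpoch_add (K : numFieldType) (a q : K) (m n : nat) :
  qpoch a q (m + n) = qpoch a q m * qpoch (a * q ^+ m) q n.
Proof.
elim: n => [|n IH]; first by rewrite addn0 qpoch0 mulr1.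
by rewrite addnS !qpochSr IH exprD !mulrA.
Qed.

Lemma qpochSl (K : numFieldType) (a q : K) (n : nat) :
  qpoch a q n.+1 = (1 - a) * qpoch (a * q) q n.
Proof. by rewrite -add1n qpoch_add qpochSr qpoch0 mul1r expr0 mulr1 expr1. Qed.

(** Gaussian binomial coefficient, for q not a root of unity. The value 0 for j > n lets the Pascal
    rule [qbinSS] hold for all j. *)
Definition qbin (K : numFieldType) (q : K) (n j : nat) : K :=
  if (j <= n)%N then qpoch q q n / (qpoch q q j * qpoch q q (n - j)) else 0.

Lemma qpoch_neq0 (K : numFieldType) (a q : K) (n : nat) :
  (forall i : nat, a * q ^+ i != 1) -> qpoch a q n != 0.
Proof.
move=> h; elim: n => [|n IH]; first by rewrite qpoch0 oner_neq0.
by rewrite qpochSr mulf_neq0 // subr_eq0 eq_sym.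
Qed.

Section QBinomial.
Variables (K : numFieldType) (q : K).
Hypothesis qn1 : forall i : nat, q * q ^+ i != 1.

Lemma qbinn0 (n : nat) : qbin q n 0 = 1.
Proof. by rewrite /qbin leq0n qpoch0 mul1r subn0 divff // qpoch_neq0. Qed.

Lemma qbinSS (n j : nat) :
  qbin q n.+1 j.+1 = qbin q n j.+1 + q ^+ (n - j) * qbin q n j.
Proof.
rewrite /qbin ltnS; case: ltngtP => [ltjn|ltnj|->].
- have [d ->] : exists d, n = (j + d.+1)%N by exists (n - j.+1)%N; lia.
  rewrite addKn subSS addKn.
  have -> : (j + d.+1 - j.+1 = d)%N by lia.
  rewrite (qpochSr _ _ (j + _)) !(qpochSr _ _ j) !(qpochSr _ _ d).
  have := qpoch_neq0 j qn1; have := qpoch_neq0 d qn1.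
  have := qn1 j; have := qn1 d; rewrite ![_ == 1]eq_sym -![1 == _]subr_eq0.
  rewrite exprD !exprS => *; field; do ?[apply/andP; split]; done.
- by rewrite mulr0 addr0.
- by rewrite !subnn qpoch0 !mulr1 add0r expr0 mul1r !divff // qpoch_neq0.
Qed.

(** Gauss's finite q-binomial theorem: the new factor 1 - q^n X reproduces the Pascal rule because n
    + j(j-1)/2 = (n - j) + j(j+1)/2. *)
Lemma coef_prod_1_sub_qX (n j : nat) :
  (\prod_(0 <= i < n) (1 - q ^+ i *: 'X : {poly K}))`_j
    = (-1) ^+ j * q ^+ (j * j.-1)./2 * qbin q n j.
Proof.
elim: n j => [|n IH] j.
  rewrite big_geq // coef1; case: j => [|j] /=; last by rewrite mulr0.
  by rewrite qbinn0 !mulr1.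
rewrite big_nat_recr //= mulrBr mulr1 -scalerAr coefB coefZ coefMX !IH.
case: j => [|j] /=; first by rewrite mulr0 subr0 !qbinn0.
rewrite qbinSS; case: (ltnP n j) => hj.
  by rewrite /qbin !ifF ?mulr0 ?subrr ?addr0 ?mulr0 //; lia.
have -> : ((j.+1 * j)./2 = (j * j.-1)./2 + j)%N.
  by case: j hj => // j _; rewrite (mulnC j.+2) half_mulnSS (mulnC j).
rewrite -[in q ^+ n](subnK hj) !exprD exprS; ring.
Qed.

End QBinomial.

Lemma coef_horner_scale (K : numFieldType) (c : K) (p r : {poly K}) (j : nat) :
  (forall x, r.[x] = p.[c * x]) -> r`_j = c ^+ j * p`_j.
Proof.
move=> hr; have -> : r = \poly_(j < size p) (c ^+ j * p`_j).
  apply: poly_eq_nonzero => x _; rewrite hr horner_poly horner_coef.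
  by apply: eq_bigr => i _; rewrite exprMn; ring.
rewrite coef_poly; case: ltnP => // hj.
by rewrite (nth_default 0 hj) mulr0.
Qed.

(** * Truncated sums as Laurent polynomials, and their two relations *)

Definition qw (K : numFieldType) (q : K) (n : nat) : K :=
  qpoch (- q) q n * q ^+ (n * n.+1)./2.

Lemma qwS (K : numFieldType) (q : K) (n : nat) :
  qw q n.+1 = qw q n * (q ^+ n.+1 * (1 + q ^+ n.+1)).
Proof. by rewrite /qw qpochSr half_mulnSS exprD exprS; ring. Qed.

Section Laurent.
Variables (K : numFieldType) (q : K).

Definition polyU (m n : nat) : {poly K} :=
  \prod_(m <= i < n) (1 - q ^+ i *: 'X).

Definition polyD (m n : nat) : {poly K} :=
  \prod_(m <= i < n) ('X - (q ^+ i)%:P).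

(* [mockP L] is X^L times the Laurent polynomial
   (X)_{L+2} (q/X)_{L+1} * (sum of the first L+1 terms of g2(X; q)),
   and [mockR L] is X^(L+1) times its image under X -> 1/X. *)
Definition mockP (L : nat) : {poly K} :=
  \sum_(0 <= n < L.+1)
    qw q n *: ('X^n * polyU n.+1 L.+2 * polyD n.+2 L.+2).

Definition mockR (L : nat) : {poly K} :=
  \sum_(0 <= n < L.+1)
    qw q n *: ('X^n * polyU n.+2 L.+2 * polyD n.+1 L.+2).

(** Write a = q^(n+1). Common factors aside, the n-th summand on the left carries X^2 (1 - aX) - (X
    - a), which equals (X - 1) ((1 - aX)(X - a) - a(1 + a)X). The ratio a(1 + a) of consecutive
    weights in [qwS] is exactly what makes the second factor a difference [T n - T n.+1]. *)
Lemma mock_telescope (L : nat) :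
  'X^2 * mockP L - mockR L =
    ('X - 1) * (polyU 1 L.+2 * polyD 1 L.+2 - qw q L.+1 *: 'X^(L.+1)).
Proof.
pose T n : {poly K} := qw q n *: ('X^n * polyU n.+1 L.+2 * polyD n.+1 L.+2).
have -> : polyU 1 L.+2 * polyD 1 L.+2 - qw q L.+1 *: 'X^(L.+1) = T 0%N - T L.+1.
  rewrite /T /qw qpoch0 mul1r expr0 scale1r mul1r.
  by rewrite /polyU /polyD !(@big_geq _ _ _ L.+2) // !mulr1.
rewrite -(opprB (T L.+1)) -(telescope_sumr T (leq0n L.+1)) /mockP /mockR.
rewrite -sumrN !mulr_sumr -sumrB !big_nat; apply: eq_bigr => n /andP[_ hn].
rewrite opprB /T qwS /polyU /polyD !(@big_ltn _ _ _ n.+1) //=.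
rewrite -!mul_polyC !polyCM polyCD [in 'X^(n.+1)]exprS.
ring.
Qed.

Lemma polyU_horner (m n : nat) (x : K) :
  (polyU m n).[x] = \prod_(m <= i < n) (1 - q ^+ i * x).
Proof. by rewrite horner_prod; apply: eq_bigr => i _; rewrite !hornerE. Qed.

Lemma polyD_horner (m n : nat) (x : K) :
  (polyD m n).[x] = \prod_(m <= i < n) (x - q ^+ i).
Proof. by rewrite horner_prod; apply: eq_bigr => i _; rewrite !hornerE. Qed.

Lemma polyU_qhorner (m n : nat) (x : K) :
  (polyU m n).[q * x] = (polyU m.+1 n.+1).[x].
Proof.
rewrite !polyU_horner big_add1; apply: eq_bigr => i _.
by rewrite exprS; ring.
Qed.

Lemma polyD_qhorner (m n : nat) (x : K) :
  (polyD m.+1 n.+1).[q * x] = q ^+ (n - m) * (polyD m n).[x].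
Proof.
rewrite !polyD_horner big_add1 -prodr_const_nat -big_split /=.
by apply: eq_bigr => i _; rewrite exprS; ring.
Qed.

Lemma polyU_inv_horner (m n : nat) (x : K) : x != 0 ->
  x ^+ (n - m) * (polyU m n).[x^-1] = (polyD m n).[x].
Proof.
move=> x0; rewrite polyU_horner polyD_horner -prodr_const_nat -big_split /=.
by apply: eq_bigr => i _; field.
Qed.

Lemma polyD_inv_horner (m n : nat) (x : K) : x != 0 ->
  x ^+ (n - m) * (polyD m n).[x^-1] = (polyU m n).[x].
Proof.
move=> x0; rewrite polyU_horner polyD_horner -prodr_const_nat -big_split /=.
by apply: eq_bigr => i _; field.
Qed.

(** True term by term: replacing X by qX moves the range of [polyU] up and that of [polyD] down by
    one, and the two linear factors account for the end points that differ. *)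
Lemma mockP_qhorner (L : nat) (x : K) :
  (mockP L).[q * x] * (x - q ^+ L.+1) =
    q ^+ L * (mockR L).[x] * (1 - q ^+ L.+2 * x).
Proof.
rewrite /mockP /mockR !horner_sum mulr_suml mulr_sumr mulr_suml !big_nat.
apply: eq_bigr => n /andP[_ hn].
rewrite !hornerZ !hornerM !hornerXn polyU_qhorner polyD_qhorner.
rewrite (polyU_horner _ L.+3) big_nat_recr //= -polyU_horner.
rewrite (polyD_horner _ L.+2) big_nat_recr //= -polyD_horner.
have -> : q ^+ L = q ^+ (L - n) * q ^+ n by rewrite -exprD subnK.
by rewrite subSS exprMn; ring.
Qed.

Lemma mockR_horner (L : nat) (x : K) : x != 0 ->
  (mockR L).[x] = x ^+ (L.*2.+1) * (mockP L).[x^-1].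
Proof.
move=> x0; rewrite /mockP /mockR !horner_sum mulr_sumr !big_nat.
apply: eq_bigr => n /andP[_ hn].
rewrite !hornerZ !hornerM !hornerXn -(@polyU_inv_horner _ _ x) //.
rewrite -(@polyD_inv_horner _ _ x) //.
have -> : (L.*2.+1 = n + n + (L.+2 - n.+1) + (L.+2 - n.+2))%N by lia.
rewrite !exprD exprVn; field.
by rewrite expf_neq0.
Qed.

Lemma size_mockP (L : nat) : (size (mockP L) <= L.*2.+2)%N.
Proof.
rewrite /mockP; apply: (leq_trans (size_sum _ _ _)).
apply/bigmax_leqP_seq => n; rewrite mem_index_iota => /andP[_ hn] _.
apply: (leq_trans (size_scale_leq _ _)).
have sprod (f : nat -> {poly K}) a b : (forall i, size (f i) <= 2)%N ->
    (size (\prod_(a <= i < b) f i)%R <= (b - a).+1)%N.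
  move=> hf; elim: b => [|b IH]; first by rewrite big_geq // size_poly1.
  case: (leqP a b) => hab; last by rewrite big_geq ?size_poly1 //; lia.
  rewrite big_nat_recr //=; apply: (leq_trans (size_polyMleq _ _)).
  by have := hf b; move: IH; set u := size _; set v := size _; lia.
have hU : (size (polyU n.+1 L.+2) <= (L.+1 - n).+1)%N.
  apply: sprod => i; apply: (leq_trans (size_polyD _ _)).
  rewrite size_polyN size_poly1 geq_max /=.
  by apply: (leq_trans (size_scale_leq _ _)); rewrite size_polyX.
have hD : (size (polyD n.+2 L.+2) <= (L - n).+1)%N.
  by apply: sprod => i; rewrite size_XsubC.
apply: (leq_trans (size_polyMleq _ _)).
have := size_polyMleq ('X^n) (polyU n.+1 L.+2); rewrite size_polyXn.
move: hU hD hn; set a := size _; set b := size _; set c := size _; lia.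
Qed.

Lemma coef_mockR (L j : nat) : (j <= L.*2.+1)%N ->
  (mockR L)`_j = (mockP L)`_(L.*2.+1 - j).
Proof.
move=> hj.
have -> : mockR L = \poly_(i < L.*2.+2) (mockP L)`_(L.*2.+1 - i).
  apply: poly_eq_nonzero => x x0; rewrite mockR_horner // horner_poly.
  rewrite (horner_coef_wide _ (size_mockP L)) mulr_sumr (reindex_inj rev_ord_inj).
  apply: eq_bigr => i _ /=; rewrite subSS.
  have hi : (i <= L.*2.+1)%N by rewrite -ltnS.
  rewrite mulrCA; congr (_ * _).
  have -> : x ^+ L.*2.+1 = x ^+ (L.*2.+1 - i) * x ^+ i by rewrite -exprD subnK.
  by rewrite exprVn mulrC mulKf // expf_neq0.
by rewrite coef_poly ltnS hj.
Qed.

(** Coefficient of X^(L+2+r) in [mock_telescope]. The last weight enters through (X - 1) X^(L+1),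
    hence only at r = 0 in this range. *)
Lemma mock_coef_rel1 (L r : nat) : (r < L)%N ->
  (mockP L)`_(L + r) - (mockP L)`_(L.-1 - r) =
  (('X - 1) * (polyU 1 L.+2 * polyD 1 L.+2))`_(L.+2 + r)
     - (if r == 0 then qw q L.+1 else 0).
Proof.
move=> hr; have := congr1 (fun p : {poly K} => p`_(L.+2 + r)) (mock_telescope L).
rewrite coefB coefXnM; have -> : (L.+2 + r < 2)%N = false by lia.
rewrite coef_mockR; last by lia.
have -> : (L.+2 + r - 2 = L + r)%N by lia.
have -> : (L.*2.+1 - (L.+2 + r) = L.-1 - r)%N by lia.
move=> ->; rewrite mulrBr coefB; congr (_ - _).
rewrite mulrBl mul1r coefB -scalerAr -exprS !coefZ !coefXn.
have -> : (L.+2 + r == L.+2) = (r == 0) by lia.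
have -> : (L.+2 + r == L.+1) = false by lia.
by case: eqP; rewrite ?mulr0 ?mulr1 subr0.
Qed.

(** Coefficient of X^(L+r+2) in [mockP_qhorner], divided by q^L. Of the three terms on the right,
    the last two carry a power of q that grows with L. *)
Lemma mock_coef_rel2 (L r : nat) : q != 0 -> (r < L)%N ->
  (mockP L)`_(L.-1 - r) = q ^+ r.+1 * (mockP L)`_(L + r.+1)
     - q ^+ (L + r.+3) * (mockP L)`_(L + r.+2) + q ^+ L.+2 * (mockP L)`_(L - r).
Proof.
move=> q0 hr.
pose Q := mockP L \Po (q *: 'X).
have hQ x : Q.[x] = (mockP L).[q * x] by rewrite horner_comp hornerZ hornerX.
have cQ j : Q`_j = q ^+ j * (mockP L)`_j by apply: coef_horner_scale.
have E : Q * ('X - (q ^+ L.+1)%:P) = q ^+ L *: (mockR L * (1 - q ^+ L.+2 *: 'X)).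
  apply: poly_eq_nonzero => x _.
  by have := mockP_qhorner L x; rewrite -hQ !hornerE.
have := congr1 (fun p : {poly K} => p`_((L + r.+1).+1)) E.
rewrite mulrBr coefB coefMX coefMC !cQ /= coefZ mulrBr mulr1 -scalerAr.
rewrite coefB coefZ coefMX /= !coef_mockR; try by lia.
have -> : (L.*2.+1 - (L + r.+1).+1 = L.-1 - r)%N by lia.
have -> : (L.*2.+1 - (L + r.+1) = L - r)%N by lia.
have -> : ((L + r.+1).+1 = L + r.+2)%N by lia.
move=> e; apply: (mulfI (expf_neq0 L q0)).
rewrite -[(mockP L)`_(L.-1 - r)](subrK (q ^+ L.+2 * (mockP L)`_(L - r))).
by rewrite mulrDr -e !exprD !exprS; ring.
Qed.

End Laurent.

(** Finite Jacobi triple product. At X = q^M x the 2M+1 linear factors become, up to the constant of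
    [prodq], the product of 1 - q^i x over 0 <= i <= 2M: each X - q^i gives -q^i (1 - q^(M-i) x),
    and the remaining factors take the indices M+1 to 2M. The q-binomial theorem then applies. *)
Lemma theta_coef (K : numFieldType) (q : K) (M r : nat) :
  q != 0 -> (forall i : nat, q * q ^+ i != 1) ->
  (('X - 1) * (polyU q 1 M.+1 * polyD q 1 M.+1))`_(M.+1 + r) =
    (-1) ^+ r * q ^+ (r * r.+1)./2 * qbin q M.*2.+1 (M.+1 + r).
Proof.
move=> q0 qn1; set A := _ * _.
have prodq n : \prod_(0 <= i < n.+1) (- q ^+ i) = (-1) ^+ n.+1 * q ^+ (n * n.+1)./2.
  elim: n => [|n IH]; first by rewrite big_nat1 expr1 !expr0 mulN1r.
  by rewrite half_mulnSS big_nat_recr //= IH exprD [in RHS](exprS (-1)); ring.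
have E x : (((-1) ^+ M.+1 * q ^+ (M * M.+1)./2) *:
      \prod_(0 <= i < M.*2.+1) (1 - q ^+ i *: 'X)).[x] = A.[q ^+ M * x].
  have e1 : (q ^+ M * x - 1) * \prod_(1 <= i < M.+1) (q ^+ M * x - q ^+ i) =
      (-1) ^+ M.+1 * q ^+ (M * M.+1)./2 * \prod_(0 <= i < M.+1) (1 - q ^+ i * x).
    rewrite -[1 in X in X * _](expr0 q) -(big_ltn (F := fun i => _ - q ^+ i)) //.
    rewrite -prodq [\prod_(0 <= i < _) (1 - _)]big_nat_rev add0n -big_split /=.
    rewrite !big_nat; apply: eq_bigr => i /andP[_ hi]; rewrite subSS.
    have -> : q ^+ M = q ^+ i * q ^+ (M - i) by rewrite -exprD subnKC.
    by ring.
  have e2 : \prod_(1 <= i < M.+1) (1 - q ^+ i * (q ^+ M * x)) =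
      \prod_(M.+1 <= i < M.*2.+1) (1 - q ^+ i * x).
    rewrite -{2}[M.+1]add1n [RHS]big_addn.
    have -> : (M.*2.+1 - M = M.+1)%N by lia.
    by apply: eq_bigr => i _; rewrite mulrA -exprD.
  rewrite hornerZ -/(polyU q 0 M.*2.+1) /A !hornerM !polyU_horner polyD_horner.
  rewrite hornerXsubC (big_cat_nat (n := M.+1)) //=; last by lia.
  by rewrite [LHS]mulrA -e1 e2 mulrAC mulrA.
have := coef_horner_scale (M.+1 + r) E.
rewrite coefZ coef_prod_1_sub_qX // -exprM => e.
apply: (mulfI (expf_neq0 (M * (M.+1 + r)) q0)); rewrite -e.
have -> : q ^+ (M * (M.+1 + r)) * ((-1) ^+ r * q ^+ (r * r.+1)./2 *
    qbin q M.*2.+1 (M.+1 + r)) = (-1) ^+ r *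
    q ^+ (M * (M.+1 + r) + (r * r.+1)./2) * qbin q M.*2.+1 (M.+1 + r).
  by rewrite exprD; ring.
have <- : ((M * M.+1)./2 + ((M.+1 + r) * (M + r))./2 =
    M * (M.+1 + r) + (r * r.+1)./2)%N.
  apply/double_inj; rewrite !doubleD !even_halfK; first by rewrite -!muln2; nia.
  - by rewrite oddM /=; case: odd.
  - by rewrite oddM !oddD /=; do 2 case: odd.
  - by rewrite oddM /=; case: odd.
rewrite (_ : (-1) ^+ r = (-1) ^+ M.+1 * (-1) ^+ (M.+1 + r)); last first.
  by rewrite exprD mulrA -expr2 sqrr_sign mul1r.
by rewrite [q ^+ (_./2 + _)]exprD addSn /=; ring.
Qed.

(** * Coefficientwise majorants *)

Section Majorant.
Variable K : numFieldType.
Implicit Types p P : {poly K}.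

Definition maj p P := forall i : nat, `|p`_i| <= P`_i.

Lemma maj_ge0 p P i : maj p P -> 0 <= P`_i.
Proof. by move/(_ i); apply: le_trans. Qed.

Lemma majC c C : `|c| <= C -> maj c%:P C%:P.
Proof. by move=> h i; rewrite !coefC; case: ifP; rewrite ?normr0. Qed.

Lemma majX : maj 'X 'X.
Proof. by move=> i; rewrite coefX normr_nat. Qed.

Lemma majN p P : maj p P -> maj (- p) P.
Proof. by move=> h i; rewrite coefN normrN. Qed.

Lemma majD p1 P1 p2 P2 : maj p1 P1 -> maj p2 P2 -> maj (p1 + p2) (P1 + P2).
Proof.
by move=> h1 h2 i; rewrite !coefD (le_trans (ler_normD _ _)) ?lerD.
Qed.

Lemma majM p1 P1 p2 P2 : maj p1 P1 -> maj p2 P2 -> maj (p1 * p2) (P1 * P2).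
Proof.
move=> h1 h2 i; rewrite !coefM; apply: (le_trans (ler_norm_sum _ _ _)).
by apply: ler_sum => j _; rewrite normrM ler_pM.
Qed.

Lemma majZ c C p P : `|c| <= C -> maj p P -> maj (c *: p) (C *: P).
Proof. by move=> hc h; rewrite -!mul_polyC; apply: majM => //; apply: majC. Qed.

Lemma maj_sum m n (f F : nat -> {poly K}) : (forall i, maj (f i) (F i)) ->
  maj (\sum_(m <= i < n) f i) (\sum_(m <= i < n) F i).
Proof.
move=> h; apply: (big_ind2 maj) => //; last by move=> *; apply: majD.
by move=> i; rewrite coef0 normr0.
Qed.

Lemma maj_prod m n (f F : nat -> {poly K}) : (forall i, maj (f i) (F i)) ->
  maj (\prod_(m <= i < n) f i) (\prod_(m <= i < n) F i).
Proof.
move=> h; apply: (big_ind2 maj) => //; last by move=> *; apply: majM.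
by rewrite -polyC1; apply: majC; rewrite normr1.
Qed.

(** Cauchy's estimate: the terms of P(x) are nonnegative, so each is at most their sum. *)
Lemma maj_coef p P x i : maj p P -> 0 <= x -> `|p`_i| * x ^+ i <= P.[x].
Proof.
move=> h x0; have P0 j : 0 <= P`_j * x ^+ j.
  by rewrite mulr_ge0 ?exprn_ge0 ?(maj_ge0 _ h).
apply: (le_trans (ler_wpM2r (exprn_ge0 i x0) (h i))).
rewrite horner_coef; case: (ltnP i (size P)) => hi.
  by rewrite (bigD1 (Ordinal hi)) //= lerDl sumr_ge0.
by rewrite (nth_default 0 hi) mul0r sumr_ge0.
Qed.

End Majorant.

Lemma normr_qpoch (K : numFieldType) (a q : K) (n : nat) :
  `|qpoch a q n| <= qpoch (- `|a|) `|q| n.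
Proof.
rewrite normr_prod; apply: ler_prod => i _; rewrite normr_ge0 /=.
by rewrite (le_trans (ler_normB _ _)) // normr1 mulNr opprK normrM normrX.
Qed.

(* Dropping the first n factors of each product only decreases the majorant,
   which is thus bounded independently of L. *)
Lemma mockP_coef_bound (K : numFieldType) (q x W B B' : K) (L i : nat) :
  0 < x ->
  (forall n, \sum_(0 <= i < n) `|qw q i| <= W) ->
  (forall n, qpoch (- x) `|q| n <= B) ->
  (forall n, qpoch (- x^-1) `|q| n <= B') ->
  `|(mockP q L)`_i| * x ^+ i <= x ^+ L * (W * (B * B')).
Proof.
move=> x0 hW hB hB'.
pose F : {poly K} := \sum_(0 <= n < L.+1) `|qw q n| *: ('X^n *
  (\prod_(n.+1 <= i < L.+2) (1 + `|q| ^+ i *: 'X)) *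
  (\prod_(n.+2 <= i < L.+2) ('X + (`|q| ^+ i)%:P))).
have mF : maj (mockP q L) F.
  apply: maj_sum => n; apply: majZ => //; apply: majM; first apply: majM.
  - by move=> j; rewrite coefXn normr_nat.
  - apply: maj_prod => j; apply: majD.
      by rewrite -polyC1; apply: majC; rewrite normr1.
    by apply: majN; apply: majZ; [rewrite normrX | apply: majX].
  - apply: maj_prod => j; apply: majD; first exact: majX.
    by apply: majN; apply: majC; rewrite normrX.
apply: (le_trans (maj_coef _ mF (ltW x0))).
have y0 : 0 < x^-1 by rewrite invr_gt0.
have tail y n m : 0 < y -> \prod_(n <= i < m) (1 + `|q| ^+ i * y) <= qpoch (- y) `|q| m.
  move=> hy; have h1 j : 1 <= 1 + `|q| ^+ j * y.
    by rewrite lerDl mulr_ge0 ?exprn_ge0 // ltW.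
  have -> : qpoch (- y) `|q| m = \prod_(0 <= i < m) (1 + `|q| ^+ i * y).
    by apply: eq_bigr => j _; rewrite mulNr opprK mulrC.
  case: (leqP n m) => hnm; last first.
    rewrite big_geq ?(ltnW hnm) //; elim: m {hnm} => [|m IH]; first by rewrite big_geq.
    by rewrite big_nat_recr //= (le_trans IH) // ler_peMr // (le_trans ler01 IH).
  rewrite [leRHS](big_cat_nat (n := n) _ hnm) //= ler_peMl //.
    by apply: prodr_ge0 => j _; apply: le_trans (h1 j).
  elim/big_rec: _ => // j z _ hz; rewrite (le_trans hz) //.
  by rewrite ler_peMl // (le_trans ler01 hz).
have B0 : 0 <= B.
  by apply: le_trans (hB 0%N); rewrite qpoch0.
have B'0 : 0 <= B'.
  by apply: le_trans (hB' 0%N); rewrite qpoch0.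
rewrite horner_sum.
have hn n : (0 <= n < L.+1)%N ->
   (`|qw q n| *: ('X^n *
  (\prod_(n.+1 <= i < L.+2) (1 + `|q| ^+ i *: 'X)) *
  (\prod_(n.+2 <= i < L.+2) ('X + (`|q| ^+ i)%:P)))).[x] <= 
   `|qw q n| * (x ^+ L * (B * B')).
  move=> /andP[_ hn]; rewrite hornerZ ler_wpM2l // !hornerM hornerXn !horner_prod.
  (* The power x^(L-n) taken out here complements x^n, so every summand carries the same x^L. *)
  have -> : \prod_(n.+2 <= i < L.+2) ('X + (`|q| ^+ i)%:P).[x] =
     x ^+ (L - n) * \prod_(n.+2 <= i < L.+2) (1 + `|q| ^+ i * x^-1).
    rewrite -subSS -(subSS n.+1) -prodr_const_nat -big_split /=.
    by apply: eq_bigr => j _; rewrite !hornerE; field; rewrite lt0r_neq0.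
  rewrite (eq_bigr (fun i => 1 + `|q| ^+ i * x)); last first.
    by move=> j _; rewrite !hornerE.
  rewrite mulrACA -exprD subnKC // (ler_wpM2l (exprn_ge0 L (ltW x0))) //.
  apply: ler_pM.
  - by apply: prodr_ge0 => j _; rewrite addr_ge0 ?mulr_ge0 ?exprn_ge0 // ltW.
  - by apply: prodr_ge0 => j _; rewrite addr_ge0 ?mulr_ge0 ?exprn_ge0 // ltW.
  - exact: le_trans (tail _ _ _ x0) (hB _).
  - exact: le_trans (tail _ _ _ y0) (hB' _).
apply: (le_trans (ler_sum_nat hn)).
rewrite -mulr_suml mulrCA (ler_wpM2l (exprn_ge0 L (ltW x0))) //.
by rewrite ler_wpM2r ?mulr_ge0.
Qed.

(** * Limits in a [numFieldType], and the case of the complex numbers *)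

Section Analysis.
Local Open Scope classical_set_scope.
Local Open Scope ring_scope.

Lemma cvgnD (K : numFieldType) (u v : nat -> K) (a b : K) :
  u @ \oo --> a -> v @ \oo --> b -> (fun n => u n + v n) @ \oo --> a + b.
Proof.
move=> hu hv; have h : (u + v) @ \oo --> a + b by apply: cvgD; [exact: hu|exact: hv].
exact: h.
Qed.

Lemma cvgnM (K : numFieldType) (u v : nat -> K) (a b : K) :
  u @ \oo --> a -> v @ \oo --> b -> (fun n => u n * v n) @ \oo --> a * b.
Proof.
move=> hu hv; have h : (u \* v) @ \oo --> a * b by apply: cvgM; [exact: hu|exact: hv].
exact: h.
Qed.

Lemma cvg0_le (K : numFieldType) (u v : nat -> K) :
  (\forall n \near \oo, `|u n| <= `|v n|) -> v @ \oo --> (0 : K) ->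
  u @ \oo --> (0 : K).
Proof.
move=> huv /cvgr0Pnorm_lt hv; apply/cvgr0Pnorm_lt => e e0.
near=> n; apply: (@le_lt_trans _ _ `|v n|); first by near: n.
by near: n; apply: hv.
Unshelve. all: by end_near. Qed.

Lemma cvg0M_bounded (K : numFieldType) (u v : nat -> K) (B : K) :
  (forall n, `|u n| <= B) -> v @ \oo --> (0 : K) ->
  (fun n => u n * v n) @ \oo --> (0 : K).
Proof.
move=> hu hv; apply: (@cvg0_le _ _ (fun n => B * v n)).
  near=> n; rewrite !normrM ler_wpM2r // (le_trans (hu n)) //.
  by rewrite ger0_norm // (le_trans _ (hu n)).
by rewrite -[0](mulr0 B); apply: cvgnM => //; apply: cvg_cst.
Unshelve. all: by end_near. Qed.

Lemma cvg_sum0 (K : numFieldType) (d : nat -> nat -> K) (T : nat) :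
  (forall r, d r @ \oo --> (0 : K)) ->
  (fun N => \sum_(0 <= r < T) d r N) @ \oo --> (0 : K).
Proof.
move=> hd; elim: T => [|T IH].
  by under eq_fun do rewrite big_geq //; apply: cvg_cst.
under eq_fun do rewrite big_nat_recr //=.
by have := cvgnD IH (hd T); rewrite addr0.
Qed.

Lemma ge0_complexE (R : realType) (x : R[i]) :
  0 <= x -> exists2 r : R, 0 <= r & x = (r%:C)%C.
Proof.
move=> x0; have xE := RRe_real (ger0_real x0).
by exists (complex.Re x) => //; rewrite -(lecR 0 (complex.Re x)) xE.
Qed.

(* The only form of completeness the proof uses; R[i] carries no complete
   normed module structure in the library. *)
Definition geometrically_complete (K : numFieldType) :=
  forall (u : nat -> K) (B a : K), `|a| < 1 ->
    (forall n, `|u n.+1 - u n| <= B * `|a| ^+ n) -> cvgn u.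

(** Real and imaginary parts are additive and do not increase the modulus, so the increments of each
    are dominated by a real geometric series; [main] treats both at once. *)
Lemma complex_geometrically_complete (R : realType) :
  geometrically_complete R[i].
Proof.
move=> u B a.
have [r r0 ar] := ge0_complexE (normr_ge0 a).
rewrite ar -[1]/((1 : R)%:C)%C ltcR => r1 hu.
have B0 : 0 <= B by have := le_trans (normr_ge0 _) (hu 0%N); rewrite expr0 mulr1.
have [b b0 Bb] := ge0_complexE B0.
have main (f : {additive R[i] -> R}) : (forall x : R[i], ((`|f x|)%:C)%C <= `|x|) ->
    cvgn (f \o u).
  move=> hf; pose v n := f (u n.+1 - u n).
  have hv n : `|v n| <= b * r ^+ n.
    by rewrite -lecR (le_trans (hf _)) // (le_trans (hu n)) // Bb -rmorphXn -rmorphM.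
  have cv : cvgn (series v).
    apply: normed_cvg; apply: (@series_le_cvg _ _ (geometric b r)).
    - by move=> n; exact: normr_ge0.
    - by move=> n; apply: mulr_ge0 => //; exact: exprn_ge0.
    - exact: hv.
    - by apply: is_cvg_geometric_series; rewrite ger0_norm.
  have -> : f \o u = (fun n => f (u 0%N) + series v n).
    apply/funext => n /=; rewrite seriesEnat /=.
    rewrite (eq_bigr (fun i => f (u i.+1) - f (u i))); last first.
      by move=> i _; rewrite /v raddfB.
    by rewrite (telescope_sumr (f \o u)) //= addrC subrK.
  by apply: is_cvgD => //; apply: is_cvg_cst.
have cRe : cvgn (@complex.Re R \o u).
  apply: (main (@complex.Re R : {additive R[i] -> R})) => x; exact: normc_ge_Re.
have cIm : cvgn (@complex.Im R \o u).
  apply: (main (@complex.Im R : {additive R[i] -> R})) => x.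
  rewrite normc_def lecR -sqrtr_sqr ler_wsqrtr // lerDr sqr_ge0 //.
have /cvgrPdist_lt hRe := cRe; have /cvgrPdist_lt hIm := cIm.
apply/cvg_ex; exists ((limn (@complex.Re R \o u)) +i* (limn (@complex.Im R \o u)))%C.
apply/cvgrPdist_lt => e e0; have [d d0 ed] := ge0_complexE (ltW e0).
move: e0; rewrite {e}ed -[0]/((0 : R)%:C)%C ltcR => d'0.
near=> n; set w := _ - u n.
have hw : `|w| <= (`|complex.Re w|%:C + `|complex.Im w|%:C)%C.
  rewrite {1}[w]complexE (le_trans (ler_normD _ _)) // normrM.
  rewrite !normc_def /= !expr0n /= !addr0 !sqrtr_sqr add0r expr1n sqrtr1 mul1r.
  by [].
apply: (le_lt_trans hw); rewrite -rmorphD ltcR [d]splitr raddfB (raddfB (@complex.Im R)).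
by rewrite ltrD //; near: n; [apply: hRe|apply: hIm]; rewrite divr_gt0.
Unshelve. all: by end_near. Qed.

Lemma qpoch_ge1 (K : numFieldType) (x a : K) (n : nat) :
  0 <= x -> 0 <= a -> 1 <= qpoch (- x) a n.
Proof.
move=> x0 a0; elim: n => [|n IH]; first by rewrite qpoch0.
rewrite qpochSr (le_trans IH) // ler_peMr ?(le_trans ler01 IH) //.
by rewrite mulNr opprK lerDl mulr_ge0 // exprn_ge0.
Qed.

Lemma half_norm (K : numFieldType) : `|2^-1 : K| = 2^-1.
Proof. by rewrite ger0_norm // invr_ge0 ler0n. Qed.

Lemma half_lt1 (K : numFieldType) : `|2^-1 : K| < 1.
Proof. by rewrite half_norm invf_lt1 ?ltr0n // ltr1n. Qed.

Lemma sum_half (K : numFieldType) (m n : nat) : (m <= n)%N ->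
  \sum_(m <= i < n) (2^-1 : K) ^+ i = 2 * 2^-1 ^+ m - 2 * 2^-1 ^+ n.
Proof.
move=> /subnKC <-; elim: (n - m)%N => [|k IH]; first by rewrite addn0 subrr big_geq.
by rewrite addnS big_nat_recr ?leq_addr //= IH exprS; field.
Qed.

(** * Consequences of geometric completeness *)

Section GeometricallyComplete.
Variable K : numFieldType.
Hypothesis hK : geometrically_complete K.

(** [K] is not assumed Archimedean. Convergence comes from [hK], the increments being (a - 1) a^n;
    the limit l satisfies a l = l with a != 1, so l = 0. *)
Lemma cvg0_expr (a : K) : `|a| < 1 -> (fun n => a ^+ n) @ \oo --> (0 : K).
Proof.
move=> a1; have /cvg_ex[l hl] : cvgn (fun n => a ^+ n : K).
  apply: (hK (B := `|a - 1|) a1) => n.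
  by rewrite exprS -[X in _ - X]mul1r -mulrBl normrM normrX.
have hl1 : (fun n => a ^+ n.+1) @ \oo --> a * l.
  by under eq_fun do rewrite exprS; apply: cvgnM => //; apply: cvg_cst.
have hl2 : (fun n => a ^+ n.+1) @ \oo --> l by rewrite (cvg_shiftS (fun n => a ^+ n)).
have /eqP : a * l = l by apply: (cvg_unique (@norm_hausdorff _ K) hl1 hl2).
rewrite -subr_eq0 -{2}[l]mul1r -mulrBl mulf_eq0 subr_eq0 => /orP[/eqP a1'|/eqP <- //].
by move: a1; rewrite a1' normr1 ltxx.
Qed.

Lemma qpoch_bounded (x a : K) : 0 <= x -> 0 <= a -> a < 1 ->
  exists B : K, forall n, qpoch (- x) a n <= B.
Proof.
move=> x0 a0 a1.
(* When 2y <= 1 - a, the bound 2 - a^n passes to n + 1 because (2 - a^n)(1 + y a^n) <= 2 - a^(n+1).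
   Splitting off the first [n0] factors reduces any x to this case. *)
have small y n : 0 <= y -> y *+ 2 <= 1 - a -> qpoch (- y) a n <= 2 - a ^+ n.
  move=> y0 hy; elim: n => [|n IH].
    by rewrite qpoch0 expr0 -[2]/(1 + 1) addrK.
  have f0 : 0 <= 1 - - y * a ^+ n.
    by rewrite mulNr opprK addr_ge0 // mulr_ge0 // exprn_ge0.
  rewrite qpochSr (le_trans (ler_wpM2r f0 IH)) // -subr_ge0.
  have -> : 2 - a ^+ n.+1 - (2 - a ^+ n) * (1 - - y * a ^+ n) =
     a ^+ n * (1 - a - y *+ 2) + y * (a ^+ n * a ^+ n) by rewrite exprS; ring.
  by rewrite addr_ge0 ?mulr_ge0 ?exprn_ge0 // subr_ge0.
have [n0 hn0] : exists n0, x * a ^+ n0 *+ 2 <= 1 - a.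
  have p0 : 0 < x *+ 2 + 1 by rewrite ltr_wpDl // mulrn_wge0.
  have := @cvg0_expr a; rewrite ger0_norm // => /(_ a1)/cvgr0Pnorm_lt.
  move=> /(_ ((1 - a) / (x *+ 2 + 1))) [|n _ hn].
    by rewrite divr_gt0 ?subr_gt0.
  exists n; have := hn n (leqnn n) => /=.
  rewrite ger0_norm ?exprn_ge0 // ltr_pdivlMr // => /ltW.
  apply: le_trans; rewrite mulrDr mulr1 mulrC mulrnAr lerDl exprn_ge0 //.
exists (qpoch (- x) a n0 * 2) => n.
(* All factors are at least 1, so lengthening the product by [n0] also covers n < [n0]. *)
apply: (@le_trans _ _ (qpoch (- x) a (n + n0))).
  rewrite qpoch_add mulNr ler_peMr ?qpoch_ge1 ?mulr_ge0 ?exprn_ge0 //.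
  by rewrite (le_trans ler01) ?qpoch_ge1.
rewrite addnC qpoch_add mulNr ler_wpM2l //.
  by rewrite (le_trans ler01) ?qpoch_ge1.
rewrite (le_trans (small _ n _ hn0)) ?mulr_ge0 ?exprn_ge0 //.
by rewrite gerBl exprn_ge0.
Qed.

Lemma cvg_qpoch (b q : K) : `|q| < 1 -> cvgn (qpoch b q).
Proof.
move=> q1; have [B hB] := qpoch_bounded (normr_ge0 b) (normr_ge0 q) q1.
apply: (hK (B := B * `|b|) q1) => n.
rewrite qpochSr mulrBr mulr1 addrC addKr normrN !normrM normrX mulrA.
by rewrite !ler_wpM2r ?exprn_ge0 // (le_trans (normr_qpoch _ _ _)).
Qed.

(** Past some N the ratios are below 1/2 in modulus; the weights 2^i in the constant absorb the
    terms up to N. The rate 1/2 is an arbitrary choice, kept throughout. *)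
Lemma ratio_decay (t c : nat -> K) :
  (forall n, t n.+1 = t n * c n) -> c @ \oo --> (0 : K) ->
  exists B : K, forall n, `|t n| <= B * 2^-1 ^+ n.
Proof.
move=> tS /cvgr0Pnorm_lt /(_ 2^-1) [|N _ hN]; first by rewrite invr_gt0 ltr0n.
exists (\sum_(0 <= i < N.+1) `|t i| * 2 ^+ i) => n.
have pos i : 0 <= `|t i| * 2 ^+ i by rewrite mulr_ge0 // exprn_ge0.
have hlow m : (m <= N)%N ->
    `|t m| <= (\sum_(0 <= i < N.+1) `|t i| * 2 ^+ i) * 2^-1 ^+ m.
  move=> hm; rewrite (bigD1_seq m) ?iota_uniq ?mem_index_iota //=.
  rewrite mulrDl exprVn mulfK ?expf_neq0 ?pnatr_eq0 // lerDl.
  by apply: mulr_ge0; [apply: sumr_ge0 | rewrite invr_ge0 exprn_ge0].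
case: (leqP n N) => [|/ltnW/subnKC <-]; first exact: hlow.
elim: (n - N)%N => [|k IH]; first by rewrite addn0 hlow.
rewrite addnS tS normrM exprSr mulrA ler_pM // ltW //.
by apply: hN; rewrite /= leq_addr.
Qed.

(** Dominated convergence with a range that grows with N: the tail beyond T is small uniformly in N,
    and below T there are finitely many null sequences. *)
Lemma tannery (d : nat -> nat -> K) (B : K) :
  (forall r N, (r < N)%N -> `|d r N| <= B * 2^-1 ^+ r) ->
  (forall r, d r @ \oo --> (0 : K)) ->
  (fun N => \sum_(0 <= r < N) d r N) @ \oo --> (0 : K).
Proof.
move=> hB hd; apply/cvgr0Pnorm_lt => e e0.
have e20 : 0 < e / 2 by rewrite divr_gt0 ?ltr0n.
have B0 : 0 <= B by have := le_trans (normr_ge0 _) (hB 0%N 1%N isT); rewrite mulr1.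
have [T hT] : exists T, B * (2 * 2^-1 ^+ T) < e / 2.
  have : (fun T => B * (2 * 2^-1 ^+ T)) @ \oo --> (B * (2 * 0) : K).
    apply: cvgnM; first exact: cvg_cst.
    apply: cvgnM; first exact: cvg_cst.
    exact: cvg0_expr (half_lt1 K).
  rewrite !mulr0 => /cvgr0Pnorm_lt /(_ _ e20) [T _ hT].
  exists T; have := hT T (leqnn T); rewrite /= ger0_norm //.
  by rewrite !mulr_ge0 // exprn_ge0 // invr_ge0.
have /cvgr0Pnorm_lt /(_ _ e20) hs := cvg_sum0 T hd.
near=> N; have TN : (T <= N)%N by near: N; exact: nbhs_infty_ge.
rewrite (big_cat_nat (n := T)) //= [e]splitr (le_lt_trans (ler_normD _ _)) //.
apply: ltrD; first by near: N.
apply: le_lt_trans hT; apply: (le_trans (ler_norm_sum _ _ _)).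
apply: (@le_trans _ _ (\sum_(T <= r < N) B * 2^-1 ^+ r)).
  rewrite !big_nat; apply: ler_sum => r /andP[_ hr]; exact: hB.
rewrite -mulr_sumr ler_wpM2l // sum_half // gerBl mulr_ge0 // exprn_ge0 //.
Unshelve. all: by end_near. Qed.

(** Going from k to k + T leaves |a|^T B plus T error terms, each eventually small. The uniform
    bound B takes the place of an initial value. *)
Lemma contraction_cvg0 (g e : nat -> nat -> K) (a B : K) : `|a| < 1 ->
  (forall k N, `|g k N| <= B) -> (forall k, e k @ \oo --> (0 : K)) ->
  (forall k, \forall N \near \oo, `|g k N| <= `|e k N| + `|a| * `|g k.+1 N|) ->
  forall k, g k @ \oo --> (0 : K).
Proof.
move=> a1 hB he hg.
(* The arbitrary d > 0 is halved at each iteration, one half paying for the new error [e k N]. *)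
have main T : forall k d, 0 < d -> \forall N \near \oo, `|g k N| <= d + `|a| ^+ T * B.
  elim: T => [|T IH] k d d0.
    by near=> N; rewrite mul1r (le_trans (hB _ _)) // lerDr ltW.
  have d20 : 0 < d / 2 by rewrite divr_gt0 ?ltr0n.
  have /cvgr0Pnorm_lt /(_ _ d20) hk := he k.
  have hk1 := IH k.+1 _ d20.
  near=> N; have h1 : `|g k N| <= `|e k N| + `|a| * `|g k.+1 N| by near: N.
  have h2 : `|e k N| < d / 2 by near: N.
  have h3 : `|g k.+1 N| <= d / 2 + `|a| ^+ T * B by near: N.
  apply: (le_trans h1); rewrite [X in X + `|a| ^+ _ * _]splitr -addrA.
  apply: lerD; first exact: ltW.
  apply: (le_trans (ler_wpM2l (normr_ge0 a) h3)).
  rewrite mulrDr exprS -mulrA lerD2r ler_piMl ?ltW //.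
move=> k; apply/cvgr0Pnorm_lt => d d0.
have d20 : 0 < d / 2 by rewrite divr_gt0 ?ltr0n.
have [T hT] : exists T, `|a| ^+ T * B < d / 2.
  have : (fun T => `|a| ^+ T * B) @ \oo --> (0 * B : K).
    by apply: cvgnM; [apply: cvg0_expr; rewrite normr_id|apply: cvg_cst].
  rewrite mul0r => /cvgr0Pnorm_lt /(_ _ d20) [T _ hT].
  exists T; have := hT T (leqnn T); rewrite /= ger0_norm // mulr_ge0 ?exprn_ge0 //.
  exact: le_trans (hB 0%N 0%N).
have hm := main T k _ d20.
near=> N; apply: (@le_lt_trans _ _ (d / 2 + `|a| ^+ T * B)); first by near: N.
by rewrite [X in _ < X]splitr ltrD2l.
Unshelve. all: by end_near. Qed.

End GeometricallyComplete.

Lemma cvgnV (K : numFieldType) (u : nat -> K) (a : K) :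
  a != 0 -> u @ \oo --> a -> (fun n => (u n)^-1) @ \oo --> a^-1.
Proof. by move=> a0 hu; apply: cvgV. Qed.

Lemma cvgn_subr0 (K : numFieldType) (u : nat -> K) (a : K) :
  (fun n => u n - a) @ \oo --> (0 : K) -> u @ \oo --> a.
Proof. by move=> h; apply/subr_cvg0. Qed.

Lemma sum_geometric_le (K : numFieldType) (a : K) (n : nat) : 0 <= a -> a < 1 ->
  \sum_(0 <= i < n) a ^+ i <= (1 - a)^-1.
Proof.
move=> a0 a1; have p : 0 < 1 - a by rewrite subr_gt0.
rewrite -[leRHS]mul1r ler_pdivlMr // mulrC.
have -> : (1 - a) * (\sum_(0 <= i < n) a ^+ i) = 1 - a ^+ n.
  elim: n => [|n IH]; first by rewrite big_geq // mulr0 subrr.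
  by rewrite big_nat_recr //= mulrDr IH exprS; ring.
by rewrite gerBl exprn_ge0.
Qed.

(** * Decay of the weights and convergence of the series of [g2] *)

Section Mock.
Variables (K : numFieldType) (q : K).
Hypothesis hK : geometrically_complete K.
Hypotheses (q0 : q != 0) (q1 : `|q| < 1).

Let qn1 (i : nat) : q * q ^+ i != 1.
Proof.
apply/eqP => h; have := congr1 (fun x => `|x|) h.
rewrite -exprS normrX normr1 => /eqP; apply/negP; rewrite lt_eqF //.
by rewrite exprn_ilt1.
Qed.

Lemma cvg0_exprS : (fun n => q ^+ n.+1) @ \oo --> (0 : K).
Proof. by rewrite (cvg_shiftS (fun n => q ^+ n)); apply: cvg0_expr. Qed.

Lemma cvg0_qwratio : (fun n => q ^+ n.+1 * (1 + q ^+ n.+1)) @ \oo --> (0 : K).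
Proof.
rewrite -[0](mul0r (1 + 0 : K)); apply: cvgnM; first exact: cvg0_exprS.
by apply: cvgnD; [apply: cvg_cst | exact: cvg0_exprS].
Qed.

Lemma qw_bound : exists B : K, forall n, `|qw q n| <= B * 2^-1 ^+ n.
Proof. by apply: (ratio_decay _ cvg0_qwratio) => n; apply: qwS. Qed.

Lemma theta_bound (y : K) : exists B : K, forall n,
  `|q ^+ (n * n.+1)./2 * y ^+ n| <= B * 2^-1 ^+ n.
Proof.
apply: (@ratio_decay _ _ (fun n => q ^+ n.+1 * y)).
  by move=> n; rewrite half_mulnSS exprD (exprS y); ring.
by rewrite -[0](mul0r y); apply: cvgnM; [exact: cvg0_exprS | apply: cvg_cst].
Qed.

Lemma cvg_series_half (t : nat -> K) (B : K) :
  (forall n, `|t n| <= B * 2^-1 ^+ n) -> cvgn (series t).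
Proof.
move=> ht; apply: (hK (B := B) (half_lt1 K)) => n.
by rewrite seriesSr addrC addKr half_norm.
Qed.

Lemma cvg_g2_series (z : K) :
  cvgn (series (fun n => qpoch (- q) q n * q ^+ (n * n.+1)./2%N /
      (qpoch z q n.+1 * qpoch (z^-1 * q) q n.+1))).
Proof.
set t := fun n => _.
have [B hB] : exists B : K, forall n, `|t n| <= B * 2^-1 ^+ n.
  apply: (@ratio_decay _ _ (fun n => q ^+ n.+1 * (1 + q ^+ n.+1) *
     ((1 - z * q ^+ n.+1)^-1 * (1 - z^-1 * q * q ^+ n.+1)^-1))).
    move=> n; rewrite /t -!/(qw q _) qwS (qpochSr _ _ n.+1) (qpochSr (z^-1 * q) _ n.+1).
    rewrite !invfM; ring.
  rewrite -[0](mul0r ((1 - z * 0)^-1 * (1 - z^-1 * q * 0)^-1)).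
  have h b : (fun n => (1 - b * q ^+ n.+1)^-1) @ \oo --> ((1 - b * 0)^-1 : K).
    apply: cvgnV; first by rewrite mulr0 subr0 oner_neq0.
    apply: cvgnD; first exact: cvg_cst.
    by apply: cvgN; apply: cvgnM; [apply: cvg_cst | exact: cvg0_exprS].
  by apply: cvgnM; [exact: cvg0_qwratio | apply: cvgnM; apply: h].
exact: cvg_series_half hB.
Qed.

(** * Partial theta sums *)

(** In the double sum, the terms with n - 2m = k have exponent k(k+1)/2 + (2k+m+1)m. This is their
    sum over m, stripped of (-1)^k q^(k(k+1)/2) and of the power of z. *)
Definition ptheta_sum (k T : nat) : K :=
  \sum_(0 <= m < T) (-1) ^+ m * q ^+ ((k.*2 + m.+1) * m).

Definition ptheta (k : nat) : K := limn (ptheta_sum k).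

Lemma ptheta_term_le (k m : nat) :
  `|(-1) ^+ m * q ^+ ((k.*2 + m.+1) * m)| <= `|q| ^+ m.
Proof.
have h : (m <= (k.*2 + m.+1) * m)%N by rewrite leq_pmull // addnS.
rewrite normrM normrX normrN1 expr1n mul1r normrX.
by apply: ler_wiXn2l => //; exact: ltW.
Qed.

Lemma ptheta_sum_cvg (k : nat) : ptheta_sum k @ \oo --> ptheta k.
Proof.
suff /cvgP : cvgn (ptheta_sum k) by [].
apply: (hK (B := 1) q1) => n.
by rewrite /ptheta_sum big_nat_recr //= addrAC subrr add0r mul1r ptheta_term_le.
Qed.

Lemma ptheta_sumS (k T : nat) :
  ptheta_sum k T.+1 = 1 - q ^+ k.*2.+2 * ptheta_sum k.+1 T.
Proof.
rewrite /ptheta_sum big_nat_recl // muln0 mulr1 mulr_sumr -sumrN; congr (_ + _).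
apply: eq_bigr => m _.
have -> : ((k.*2 + m.+2) * m.+1 = k.*2.+2 + (k.+1.*2 + m.+1) * m)%N by nia.
by rewrite exprD exprS; ring.
Qed.

(** Multiplied by (-1)^k q^(k(k+1)/2), this becomes the recurrence of the limiting coefficients. *)
Lemma pthetaS (k : nat) : ptheta k = 1 - q ^+ k.*2.+2 * ptheta k.+1.
Proof.
have h1 : (fun T => ptheta_sum k T.+1) @ \oo --> ptheta k.
  by rewrite (cvg_shiftS (ptheta_sum k)); apply: ptheta_sum_cvg.
have h2 : (fun T => ptheta_sum k T.+1) @ \oo --> 1 - q ^+ k.*2.+2 * ptheta k.+1.
  under eq_fun do rewrite ptheta_sumS.
  apply: cvgnD; first exact: cvg_cst.
  by apply: cvgN; apply: cvgnM; [apply: cvg_cst | exact: ptheta_sum_cvg].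
exact: (cvg_unique (@norm_hausdorff _ K) h1 h2).
Qed.

Lemma ptheta_sum_bound (k T : nat) : `|ptheta_sum k T| <= (1 - `|q|)^-1.
Proof.
apply: le_trans (sum_geometric_le T (normr_ge0 q) q1).
apply: (le_trans (ler_norm_sum _ _ _)); apply: ler_sum => m _.
exact: ptheta_term_le.
Qed.

(** * Normalised q-binomial coefficients *)

(** Uniformity in m matters: in [cvg1_qbin] both the start and the length of a product vary with
    L. *)
Lemma qpoch_sub1_bound : exists B : K, forall n m,
  `|qpoch (q * q ^+ n) q m - 1| <= B * `|q| ^+ n.
Proof.
have [B hB] := qpoch_bounded hK ler01 (normr_ge0 q) q1.
have hq n m : `|qpoch (q * q ^+ n) q m| <= B.
  apply: le_trans (hB m); rewrite normr_prod; apply: ler_prod => i _.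
  rewrite normr_ge0 (le_trans (ler_normB _ _)) // normr1 mulN1r opprK lerD2l.
  by rewrite normrM normrX ler_piMl // -exprS normrX exprn_ile1 // ltW.
exists (B * (1 - `|q|)^-1) => n m.
have B0 : 0 <= B by exact: le_trans (hq 0%N 0%N).
apply: (@le_trans _ _ (B * `|q| ^+ n * \sum_(0 <= i < m) `|q| ^+ i)); last first.
  rewrite mulrAC ler_wpM2r ?exprn_ge0 // ler_wpM2l //.
  exact: sum_geometric_le.
elim: m => [|m IH]; first by rewrite qpoch0 subrr normr0 big_geq // mulr0.
rewrite qpochSr big_nat_recr //= mulrBr mulr1 addrAC mulrDr.
rewrite (le_trans (ler_normB _ _)) // lerD // !normrM !normrX -mulrA -mulrA.
rewrite ler_pM ?mulr_ge0 ?exprn_ge0 // mulrA ler_wpM2r ?exprn_ge0 //.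
by rewrite ler_piMl ?exprn_ge0 // ltW.
Qed.

Lemma cvg0_expr_subn (r : nat) : (fun L => q ^+ (L.+1 - r)) @ \oo --> (0 : K).
Proof.
apply: (@cvg0_le _ _ (fun L => q ^+ L.+1 * (q ^+ r)^-1)); last first.
  rewrite -[0](mul0r ((q ^+ r)^-1)).
  by apply: cvgnM; [exact: cvg0_exprS | apply: cvg_cst].
near=> L; have rL : (r <= L.+1)%N by apply: leqW; near: L; exact: nbhs_infty_ge.
by rewrite -[in X in _ <= X](subnK rL) exprD mulfK // expf_neq0.
Unshelve. all: by end_near. Qed.

Lemma cvg1_qpoch_tail (u : nat -> K) (r : nat) (n m : nat -> nat) :
  (\forall L \near \oo, (L.+1 - r <= n L)%N) ->
  (\forall L \near \oo, u L = qpoch (q * q ^+ n L) q (m L)) ->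
  u @ \oo --> (1 : K).
Proof.
move=> hn hu; have [B hB] := qpoch_sub1_bound; apply: cvgn_subr0.
have B0 : 0 <= B by have := le_trans (normr_ge0 _) (hB 0%N 0%N); rewrite mulr1.
apply: (@cvg0_le _ _ (fun L => B * q ^+ (L.+1 - r))); last first.
  by rewrite -[0](mulr0 B); apply: cvgnM; [apply: cvg_cst | exact: cvg0_expr_subn].
near=> L; have -> : u L = qpoch (q * q ^+ n L) q (m L) by near: L.
rewrite (le_trans (hB _ _)) // normrM (ger0_norm B0) ler_wpM2l // normrX.
apply: ler_wiXn2l => //; first exact: ltW.
by near: L.
Unshelve. all: by end_near. Qed.

(** With M = L + 1, the quotients (q;q)_M / (q;q)_(M-r) and (q;q)_(2M+1) / (q;q)_(M+1+r) are [A] and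
    [A']: stretches of (q;q)_oo that recede to infinity, hence tend to 1. *)
Lemma cvg1_qbin (r : nat) :
  (fun L => qpoch q q L.+1 * qbin q L.+1.*2.+1 (L.+2 + r)) @ \oo --> (1 : K).
Proof.
pose A L := qpoch (q * q ^+ (L.+1 - r)) q r.
pose A' L := qpoch (q * q ^+ (L.+2 + r)) q (L.+1 - r).
have hA : A @ \oo --> (1 : K).
  by apply: (@cvg1_qpoch_tail A r (fun L => L.+1 - r)%N (fun=> r)); near=> L.
have hA' : A' @ \oo --> (1 : K).
  apply: (@cvg1_qpoch_tail A' r (fun L => L.+2 + r)%N (fun L => L.+1 - r)%N).
    by near=> L; lia.
  by near=> L.
have := cvgnM hA hA'; rewrite mulr1; apply: cvg_trans; apply: near_eq_cvg.
near=> L; have rL : (r <= L.+1)%N by apply: leqW; near: L; exact: nbhs_infty_ge.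
rewrite /A /A' /qbin ifT; last by lia.
have -> : (L.+1.*2.+1 - (L.+2 + r) = L.+1 - r)%N by lia.
have -> : (L.+1.*2.+1 = (L.+2 + r) + (L.+1 - r))%N by lia.
rewrite -[X in _ = qpoch q q X * _](subnK rL) (qpoch_add _ _ (L.+1 - r) r)
  (qpoch_add _ _ (L.+2 + r)).
by field; rewrite (qpoch_neq0 (L.+2 + r) qn1) (qpoch_neq0 (L.+1 - r) qn1).
Unshelve. all: by end_near. Qed.

(** * Limits of the normalised coefficients *)

Let F (L i : nat) : K := qpoch q q L.+1 * (mockP q L)`_i.

Lemma mock_bound (x : K) : 0 < x -> exists B : K,
  forall L i, `|F L i| * x ^+ i <= x ^+ L * B.
Proof.
move=> x0; have [B1 hB1] := qw_bound.
have [B2 hB2] := qpoch_bounded hK (ltW x0) (normr_ge0 q) q1.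
have y0 : 0 <= x^-1 by rewrite invr_ge0 ltW.
have [B3 hB3] := qpoch_bounded hK y0 (normr_ge0 q) q1.
have [B4 hB4] := qpoch_bounded hK (normr_ge0 q) (normr_ge0 q) q1.
have B10 : 0 <= B1 by have := le_trans (normr_ge0 _) (hB1 0%N); rewrite mulr1.
have B20 : 0 <= B2 by apply: le_trans (hB2 0%N); rewrite qpoch0.
have B30 : 0 <= B3 by apply: le_trans (hB3 0%N); rewrite qpoch0.
exists (B4 * (B1 * 2 * (B2 * B3))) => L i.
have hW n : \sum_(0 <= i < n) `|qw q i| <= B1 * 2.
  apply: (@le_trans _ _ (\sum_(0 <= i < n) B1 * 2^-1 ^+ i)).
    by apply: ler_sum => j _; apply: hB1.
  rewrite -mulr_sumr ler_wpM2l // sum_half // expr0 mulr1 gerBl mulr_ge0 // exprn_ge0 //.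
have h := mockP_coef_bound L i x0 hW hB2 hB3.
rewrite normrM -[leLHS]mulrA [leRHS]mulrCA; apply: ler_pM => //.
  by rewrite mulr_ge0 // exprn_ge0 // ltW.
exact: le_trans (normr_qpoch _ _ _) (hB4 _).
Qed.

Lemma mock_bounded : exists B : K, forall L i, `|F L i| <= B.
Proof.
have [B hB] := mock_bound ltr01; exists B => L i.
by have := hB L i; rewrite !expr1n mulr1 mul1r.
Qed.

Let th (r : nat) : K := (-1) ^+ r * q ^+ (r * r.+1)./2.

Lemma thS (r : nat) : th r.+1 = - q ^+ r.+1 * th r.
Proof. by rewrite /th half_mulnSS exprD [(-1) ^+ _]exprS; ring. Qed.

Let J (L r : nat) : K :=
  th r * (qpoch q q L.+1 * qbin q L.+1.*2.+1 (L.+2 + r))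
    - (if r == 0 then qpoch q q L.+1 * qw q L.+1 else 0).

Lemma cvg_J (r : nat) : J ^~ r @ \oo --> th r.
Proof.
have -> : th r = th r * 1 - 0 by rewrite mulr1 subr0.
apply: cvgnD; first by apply: cvgnM; [apply: cvg_cst | exact: cvg1_qbin].
apply: cvgN; case: eqP => _; last exact: cvg_cst.
have [B hB] := qpoch_bounded hK (normr_ge0 q) (normr_ge0 q) q1.
apply: (@cvg0M_bounded _ _ _ B).
  by move=> n; exact: le_trans (normr_qpoch _ _ _) (hB _).
rewrite (cvg_shiftS (qw q)); have [B' hB'] := qw_bound.
have B'0 : 0 <= B' by have := le_trans (normr_ge0 _) (hB' 0%N); rewrite mulr1.
apply: (@cvg0_le _ _ (fun n => B' * 2^-1 ^+ n)); last first.
  rewrite -[0](mulr0 B'); apply: cvgnM; first exact: cvg_cst.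
  by apply: cvg0_expr; [|exact: half_lt1].
near=> n; rewrite [leRHS]normrM (ger0_norm B'0) [X in _ * X]ger0_norm ?hB' //.
Unshelve. all: by end_near. Qed.

Lemma mock_reflect (L r : nat) : (r < L)%N ->
  F L (L + r) - F L (L.-1 - r) = J L r.
Proof.
move=> hr; rewrite /F -mulrBr mock_coef_rel1 // theta_coef // /J mulrBr.
by congr (_ - _); [rewrite /th; ring | case: eqP; rewrite ?mulr0].
Qed.

Lemma mock_shift (L r : nat) : (r < L)%N ->
  F L (L.-1 - r) = q ^+ r.+1 * F L (L + r.+1)
     - q ^+ (L + r.+3) * F L (L + r.+2) + q ^+ L.+2 * F L (L - r).
Proof. by move=> hr; rewrite /F mock_coef_rel2 //; ring. Qed.

Lemma th_bound : exists B : K, forall k, `|th k * ptheta k| <= B.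
Proof.
have [B1 hB1] := theta_bound 1; exists (B1 * ((1 - `|q|)^-1 + 1)) => k.
have B10 : 0 <= B1 by have := le_trans (normr_ge0 _) (hB1 0%N); rewrite mulr1.
rewrite normrM; apply: ler_pM => //.
  rewrite /th normrM normrX normrN1 expr1n mul1r.
  have := hB1 k; rewrite expr1n mulr1 => /le_trans; apply.
  by rewrite ler_piMr // exprn_ile1 // -half_norm ltW // half_lt1.
have /cvgrPdist_lt /(_ 1 ltr01) [T _ hT] := @ptheta_sum_cvg k.
rewrite -[ptheta k](subrK (ptheta_sum k T)) addrC (le_trans (ler_normD _ _)) //.
by rewrite lerD ?ptheta_sum_bound // ltW // hT /=.
Qed.

Lemma cvg_mock (r : nat) : (fun L => F L (L + r)) @ \oo --> th r * ptheta r.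
Proof.
have [B hB] := mock_bounded; have [B' hB'] := th_bound.
(* The two vanishing terms of [mock_shift] are written as q^(L+1) times quantities bounded in L. *)
pose e k L := (J L k - th k) - q ^+ L.+1 * (q ^+ k.+2 * F L (L + k.+2))
  + q ^+ L.+1 * (q * F L (L - k)).
apply: cvgn_subr0.
apply: (contraction_cvg0 hK (g := fun k L => F L (L + k) - th k * ptheta k)
  (e := e) (B := B + B') q1) => [k N|k|k].
- by rewrite (le_trans (ler_normB _ _)) // lerD.
- have h0 (c : K) (n : nat -> nat) :
      (fun L => q ^+ L.+1 * (c * F L (n L))) @ \oo --> (0 : K).
    under eq_fun do rewrite mulrC.
    apply: (@cvg0M_bounded _ _ _ (`|c| * B)); last exact: cvg0_exprS.
    by move=> L; rewrite normrM ler_wpM2l.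
  rewrite -[0](addr0 (0 : K)) -{1}(subr0 (0 : K)) /e; apply: cvgnD; last exact: h0.
  apply: cvgnD; last by apply: cvgN; apply: h0.
  rewrite -(subrr (th k)); apply: cvgnD; first exact: cvg_J.
  exact: cvg_cst.
- near=> L; have kL : (k < L)%N by near: L; exact: nbhs_infty_ge.
  have := mock_reflect kL; rewrite (mock_shift kL) => /(canRL (subrK _)) E.
  (* The recurrence of the coefficients minus that of [th k * ptheta k]; the factor of the next
     difference has modulus at most |q|. *)
  have -> : F L (L + k) - th k * ptheta k =
      e k L + q ^+ k.+1 * (F L (L + k.+1) - th k.+1 * ptheta k.+1).
    rewrite E pthetaS thS /e.
    have -> : q ^+ k.*2.+2 = q ^+ k.+1 * q ^+ k.+1.
      by rewrite -exprD; congr (_ ^+ _); lia.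
    have -> : q ^+ (L + k.+3) = q ^+ L.+1 * q ^+ k.+2.
      by rewrite -exprD; congr (_ ^+ _); lia.
    by rewrite (exprS q L.+1); ring.
  rewrite (le_trans (ler_normD _ _)) // lerD2l normrM ler_wpM2r // exprS normrM.
  by rewrite ler_piMr // normrX exprn_ile1 // ltW.
Unshelve. all: by end_near. Qed.

(** By reflection the limit is that of [cvg_mock] minus [th r]. The -1 deletes the m = 0 term of the
    partial theta series, just as the second inner sum of [rhs_term] starts at m = 1. *)
Lemma cvg_mock_neg (r : nat) :
  (fun L => F L (L.-1 - r)) @ \oo --> th r * (ptheta r - 1).
Proof.
rewrite mulrBr mulr1.
have h : (fun L => F L (L + r) - J L r) @ \oo --> th r * ptheta r - th r.
  by apply: cvgnD; [exact: cvg_mock | apply: cvgN; exact: cvg_J].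
apply: cvg_trans h; apply: near_eq_cvg; near=> L.
have rL : (r < L)%N by near: L; exact: nbhs_infty_ge.
by rewrite -(mock_reflect rL); ring.
Unshelve. all: by end_near. Qed.

(** * Regrouping the double sum by powers of z *)

(** Substitution r = n - 2m: the condition n < N becomes 2m < N - r, that is, m <
    [(N - r).+1./2]. *)
Lemma sum_reindex (A : nat -> nat -> K) (N : nat) :
  \sum_(0 <= n < N) \sum_(0 <= m < n./2.+1) A (n - m.*2)%N m =
  \sum_(0 <= r < N) \sum_(0 <= m < (N - r).+1./2) A r m.
Proof.
transitivity (\sum_(0 <= n < N) \sum_(0 <= m < N)
    if (m.*2 <= n)%N then A (n - m.*2)%N m else 0).
  rewrite !big_nat; apply: eq_bigr => n /andP[_ hn].
  rewrite (big_nat_widen _ _ N) /=; last by lia.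
  by rewrite big_mkcond; apply: eq_bigr => m _; congr (if _ then _ else _); lia.
transitivity (\sum_(0 <= r < N) \sum_(0 <= m < N)
    if (r + m.*2 < N)%N then A r m else 0); last first.
  rewrite !big_nat; apply: eq_bigr => r /andP[_ hr].
  rewrite [RHS](big_nat_widen _ _ N) /=; last by lia.
  rewrite [RHS]big_mkcond; apply: eq_bigr => m _; congr (if _ then _ else _); lia.
rewrite exchange_big_nat [RHS]exchange_big_nat /=; apply: eq_bigr => m _.
rewrite -!big_mkcond /=.
transitivity (\sum_(0 <= r < N - m.*2) A r m).
  transitivity (\sum_(m.*2 <= n < N) A (n - m.*2)%N m).
    by rewrite [RHS](big_nat_widenl _ 0).
  rewrite -{1}[m.*2]add0n big_addn.
  by apply: eq_bigr => i _; rewrite addnK.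
rewrite [LHS](big_nat_widen _ _ N) ?leq_subr //=.
by apply: eq_bigl => i; lia.
Qed.

Lemma qexp_addn (r m : nat) :
  qexp (r + m.*2) m = ((r * r.+1)./2 + (r.*2 + m.+1) * m)%N.
Proof.
rewrite /qexp.
have e : ((r * r.+1)./2.*2 = r * r.+1)%N.
  by apply: even_halfK; rewrite oddM /=; case: odd.
have -> : (r + m.*2)%N%:Z ^+ 2 - 2%:Z * m%:Z ^+ 2 + (r + m.*2)%N%:Z =
    ((r * r.+1)./2 + (r.*2 + m.+1) * m)%N%:Z * 2.
  suff : ((r + m.*2) * (r + m.*2) + (r + m.*2) =
    ((r * r.+1)./2.*2 + (r.*2 + m.+1) * m * 2) + 2 * m * m)%N by lia.
  by rewrite e; nia.
by rewrite mulzK.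
Qed.

Section HeckeSum.
Variable z : K.
Hypotheses (z0 : z != 0) (zq : forall m : int, z != q ^ m).

Lemma rhs_series (N : nat) :
  series (rhs_term z q) N =
    \sum_(0 <= r < N) z ^+ r * (th r * ptheta_sum r (N - r).+1./2)
  + \sum_(0 <= r < N) z^-1 ^+ r.+1 * (th r * (ptheta_sum r (N - r).+1./2 - 1)).
Proof.
pose t r m : K := th r * ((-1) ^+ m * q ^+ ((r.*2 + m.+1) * m)).
pose A r m : K := z ^+ r * t r m.
(* The value 0 at m = 0 extends the second inner sum to the range that [sum_reindex] expects. *)
pose B r m : K := if m == 0 then 0 else z^-1 ^+ r.+1 * t r m.
have hS r T : th r * ptheta_sum r T = \sum_(0 <= m < T) t r m.
  by rewrite /ptheta_sum mulr_sumr.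
have -> : \sum_(0 <= r < N) z ^+ r * (th r * ptheta_sum r (N - r).+1./2) =
    \sum_(0 <= r < N) \sum_(0 <= m < (N - r).+1./2) A r m.
  by apply: eq_bigr => r _; rewrite hS mulr_sumr.
have -> : \sum_(0 <= r < N) z^-1 ^+ r.+1 *
      (th r * (ptheta_sum r (N - r).+1./2 - 1)) =
    \sum_(0 <= r < N) \sum_(0 <= m < (N - r).+1./2) B r m.
  rewrite !big_nat; apply: eq_bigr => r /andP[_ hr].
  rewrite mulrBr hS mulr1 !(@big_ltn _ _ _ 0); try by lia.
  rewrite {1}/t muln0 mulr1 mulr1 addrAC subrr add0r add0r mulr_sumr !big_nat.
  by apply: eq_bigr => m /andP[hm _]; rewrite /B ifF //; lia.
rewrite -!sum_reindex -big_split seriesEnat /=; apply: eq_bigr => n _.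
have et m : (m < n./2.+1)%N ->
    (-1) ^+ (m + n)%N * q ^ (qexp n m) = t (n - m.*2)%N m.
  move=> hm; have {1 2}-> : n = (n - m.*2 + m.*2)%N by lia.
  rewrite qexp_addn -exprnP exprD /t /th !exprD.
  by rewrite -mul2n (exprM _ 2) sqrrN expr1n expr1n; ring.
rewrite /rhs_term; congr (_ + _).
  rewrite !big_nat; apply: eq_bigr => m /andP[_ hm].
  rewrite mulrAC et // mulrC /A; congr (_ * _).
  by rewrite [RHS]exprnP; congr (_ ^ _); lia.
rewrite [RHS](@big_ltn _ _ _ 0) // {1}/B add0r !big_nat.
apply: eq_bigr => m /andP[hm1 hm].
rewrite mulrAC et // mulrC /B ifF; last by lia.
congr (_ * _); by rewrite exprVn [RHS]exprnN; congr (_ ^ _); lia.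
Qed.

(** * Evaluation at z and passage to the limit *)

Lemma mockP_g2 (L : nat) :
  (mockP q L).[z] = z ^+ L * ((1 - z) *
    (qpoch (z * q) q L.+1 * qpoch (z^-1 * q) q L.+1) *
    series (fun n => qpoch (- q) q n * q ^+ (n * n.+1)./2%N /
      (qpoch z q n.+1 * qpoch (z^-1 * q) q n.+1)) L.+1).
Proof.
have hz1 i : z * q ^+ i != 1.
  apply/eqP => h; have /eqP := zq (- i%:Z); apply.
  by rewrite -exprnN -[LHS](mulfK (expf_neq0 i q0)) h mul1r.
have hz2 i : z^-1 * q * q ^+ i != 1.
  apply/eqP => h; have /eqP := zq i.+1; apply.
  by rewrite -[LHS]mulr1 -h -mulrA -exprS mulVKf.
have hp1 n : qpoch z q n != 0 by apply: qpoch_neq0.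
have hp2 n : qpoch (z^-1 * q) q n != 0 by apply: qpoch_neq0.
rewrite [(1 - z) * (_ * _)]mulrA -qpochSl seriesEnat /= !mulr_sumr horner_sum !big_nat.
apply: eq_bigr => n /andP[_ hn].
rewrite hornerZ !hornerM hornerXn polyU_horner polyD_horner.
have -> : qpoch z q L.+2 = qpoch z q n.+1 * \prod_(n.+1 <= i < L.+2) (1 - q ^+ i * z).
  rewrite /qpoch (big_cat_nat (n := n.+1)) //=; last by lia.
  by congr (_ * _); apply: eq_bigr => i _; rewrite mulrC.
have -> : qpoch (z^-1 * q) q L.+1 = qpoch (z^-1 * q) q n.+1 *
     \prod_(n.+2 <= i < L.+2) (1 - q ^+ i * z^-1).
  rewrite /qpoch (big_cat_nat (n := n.+1)) //= [in RHS]big_add1 /=.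
  by congr (_ * _); apply: eq_bigr => i _; rewrite exprS; ring.
have -> : \prod_(n.+2 <= i < L.+2) (z - q ^+ i) =
    z ^+ (L - n) * \prod_(n.+2 <= i < L.+2) (1 - q ^+ i * z^-1).
  rewrite -subSS -(subSS n.+1) -prodr_const_nat -big_split /=.
  by apply: eq_bigr => i _; field.
have -> : z ^+ L = z ^+ n * z ^+ (L - n) by rewrite -exprD subnKC.
by rewrite -/(qw q n); field; rewrite hp1 hp2.
Qed.

(** The 2L+2 coefficients belong to z^(-L), ..., z^(L+1). Pairing r with -1-r leaves the two top
    ones without a partner, so they are set apart. *)
Lemma mockP_split (L : nat) : (mockP q L).[z] = z ^+ L * (
  \sum_(0 <= r < L) z ^+ r * (mockP q L)`_(L + r)
  + \sum_(0 <= r < L) z^-1 ^+ r.+1 * (mockP q L)`_(L.-1 - r)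
  + (z ^+ L * (mockP q L)`_(L + L) + z ^+ L.+1 * (mockP q L)`_(L + L.+1))).
Proof.
rewrite (horner_coef_wide _ (size_mockP q L)).
rewrite -(big_mkord xpredT (fun i => (mockP q L)`_i * z ^+ i)).
rewrite (big_cat_nat (n := L)) //=; last by lia.
rewrite [X in _ + X = _](_ : _ =
    z ^+ L * \sum_(0 <= r < L.+2) z ^+ r * (mockP q L)`_(L + r)).
  have -> : \sum_(0 <= i < L) (mockP q L)`_i * z ^+ i =
      z ^+ L * \sum_(0 <= r < L) z^-1 ^+ r.+1 * (mockP q L)`_(L.-1 - r).
    rewrite big_nat_rev /= add0n mulr_sumr !big_nat.
    apply: eq_bigr => r /andP[_ hr].
    have -> : (L - r.+1 = L.-1 - r)%N by lia.
    have -> : z ^+ L = z ^+ (L.-1 - r) * z ^+ r.+1.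
      by rewrite -exprD; congr (_ ^+ _); lia.
    by rewrite exprVn; field; rewrite expf_neq0.
  by rewrite !big_nat_recr //=; ring.
rewrite -{1}[L]add0n big_addn mulr_sumr.
have -> : (L.*2.+2 - L = L.+2)%N by lia.
by apply: eq_bigr => i _; rewrite exprD [(i + L)%N]addnC; ring.
Qed.

Lemma ptheta_sum_half_cvg (r : nat) :
  (fun N => ptheta_sum r (N - r).+1./2) @ \oo --> ptheta r.
Proof.
apply/cvgrPdist_lt => e e0.
have /cvgrPdist_lt /(_ _ e0) [T _ hT] := @ptheta_sum_cvg r.
exists (T.*2 + r)%N => // N /= hN; apply: hT => /=; lia.
Qed.

Lemma th_ptheta_bound (y : K) : exists B : K, forall r N,
  `|y ^+ r * (th r * ptheta_sum r N)| <= B * 2^-1 ^+ r /\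
  `|y ^+ r * (th r * (ptheta_sum r N - 1))| <= B * 2^-1 ^+ r.
Proof.
have [B hB] := theta_bound y; exists (B * ((1 - `|q|)^-1 + 1)) => r N.
have h (p : K) : `|p| <= (1 - `|q|)^-1 + 1 ->
    `|y ^+ r * (th r * p)| <= B * ((1 - `|q|)^-1 + 1) * 2^-1 ^+ r.
  move=> hp; rewrite mulrA normrM [leRHS]mulrAC; apply: ler_pM => //.
  apply: le_trans (hB r); rewrite /th mulrCA normrM normrX normrN1 expr1n mul1r.
  by rewrite mulrC.
split; apply: h.
  by rewrite (le_trans (ptheta_sum_bound _ _)) // lerDl.
by rewrite (le_trans (ler_normB _ _)) // normr1 lerD2r ptheta_sum_bound.
Qed.

(** Radius 2|z| in [mock_bound]: the surplus factor 2^r gives the domination. *)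
Lemma mock_pos_bound : exists B : K, forall L r,
  `|z ^+ r * F L (L + r)| <= B * 2^-1 ^+ r.
Proof.
have x0 : 0 < 2 * `|z| by rewrite mulr_gt0 ?ltr0n ?normr_gt0.
have [B hB] := mock_bound x0; exists B => L r.
have := hB L (L + r)%N; rewrite exprD mulrCA ler_pM2l ?exprn_gt0 //.
rewrite exprMn exprVn ler_pdivlMr ?exprn_gt0 ?ltr0n // => h.
by apply: le_trans h; rewrite normrM normrX le_eqVlt; apply/orP; left; apply/eqP; ring.
Qed.

(** Negative powers call for a radius below |z|; |z|/2 yields 2^(-r-1). The condition r < L keeps
    the truncated subtraction [L.-1 - r] exact. *)
Lemma mock_neg_bound : exists B : K, forall L r, (r < L)%N ->
  `|z^-1 ^+ r.+1 * F L (L.-1 - r)| <= B * 2^-1 ^+ r.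
Proof.
have nz0 : 0 < `|z| by rewrite normr_gt0.
have x0 : 0 < 2^-1 * `|z| by rewrite mulr_gt0 ?invr_gt0 ?ltr0n.
have [B hB] := mock_bound x0; exists B => L r rL.
have B0 : 0 <= B by have := hB 0%N 0%N; rewrite !expr0 mulr1 mul1r; exact: le_trans.
have := hB L (L.-1 - r)%N.
have -> : (2^-1 * `|z|) ^+ L = (2^-1 * `|z|) ^+ (L.-1 - r) * (2^-1 * `|z|) ^+ r.+1.
  by rewrite -exprD; congr (_ ^+ _); lia.
rewrite mulrC -mulrA ler_pM2l ?exprn_gt0 // => h.
rewrite normrM normrX normfV [X in X * _]exprVn mulrC ler_pdivrMr ?exprn_gt0 //.
apply: (le_trans h).
have -> : (2^-1 * `|z|) ^+ r.+1 * B = 2^-1 * (B * 2^-1 ^+ r * `|z| ^+ r.+1).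
  by rewrite exprMn (exprS 2^-1); ring.
rewrite ler_piMl //; first by rewrite !mulr_ge0 ?exprn_ge0 // invr_ge0 ler0n.
by rewrite -half_norm ltW // half_lt1.
Qed.

Theorem hecke_sum_g2 :
  has_sum (rhs_term z q)
    ((1 - z) *
     (qpoch_inf (z * q) q * qpoch_inf (z^-1 * q) q * qpoch_inf q q) *
     g2 z q).
Proof.
(* The partial theta sums in [d1] and [d2] are cut exactly where the first L terms of the double sum
   cut them. Hence [E] below is an identity for every L, and the convergence of the double series
   comes out together with its value. *)
pose d1 r L := z ^+ r * (F L (L + r) - th r * ptheta_sum r (L - r).+1./2).
pose d2 r L :=
  z^-1 ^+ r.+1 * (F L (L.-1 - r) - th r * (ptheta_sum r (L - r).+1./2 - 1)).
pose d3 L := z ^+ L * F L (L + L) + z ^+ L.+1 * F L (L + L.+1).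
pose G L := (1 - z) * (qpoch (z * q) q L.+1 * qpoch (z^-1 * q) q L.+1 *
  qpoch q q L.+1) * series (fun n => qpoch (- q) q n * q ^+ (n * n.+1)./2%N /
      (qpoch z q n.+1 * qpoch (z^-1 * q) q n.+1)) L.+1.
have [Bp hBp] := mock_pos_bound; have [Bn hBn] := mock_neg_bound.
have [Ct hCt] := th_ptheta_bound z; have [Ct' hCt'] := th_ptheta_bound z^-1.
have h1 : (fun L => \sum_(0 <= r < L) d1 r L) @ \oo --> (0 : K).
  apply: (@tannery _ hK _ (Bp + Ct)) => [r L rL|r].
    rewrite /d1 mulrBr mulrDl (le_trans (ler_normB _ _)) // lerD //.
    by have [] := hCt r (L - r).+1./2.
  rewrite -[0](mulr0 (z ^+ r)); apply: cvgnM; first exact: cvg_cst.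
  rewrite -[0](subrr (th r * ptheta r)); apply: cvgnD; first exact: cvg_mock.
  by apply: cvgN; apply: cvgnM; [apply: cvg_cst | exact: ptheta_sum_half_cvg].
have h2 : (fun L => \sum_(0 <= r < L) d2 r L) @ \oo --> (0 : K).
  apply: (@tannery _ hK _ (Bn + `|z^-1| * Ct')) => [r L rL|r].
    rewrite /d2 mulrBr mulrDl (le_trans (ler_normB _ _)) // lerD ?hBn //.
    rewrite exprS -[X in `|X|]mulrA normrM -[leRHS]mulrA ler_wpM2l //.
    by have [] := hCt' r (L - r).+1./2.
  rewrite -[0](mulr0 (z^-1 ^+ r.+1)); apply: cvgnM; first exact: cvg_cst.
  rewrite -[0](subrr (th r * (ptheta r - 1))); apply: cvgnD; first exact: cvg_mock_neg.
  apply: cvgN; apply: cvgnM; first exact: cvg_cst.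
  by apply: cvgnD; [exact: ptheta_sum_half_cvg | apply: cvg_cst].
have h3 : d3 @ \oo --> (0 : K).
  have hg : (fun L => (Bp + Bp) * 2^-1 ^+ L) @ \oo --> (0 : K).
    rewrite -[0](mulr0 (Bp + Bp)); apply: cvgnM; first exact: cvg_cst.
    by apply: cvg0_expr; [|exact: half_lt1].
  apply: cvg0_le hg; near=> L.
  have Bp0 : 0 <= Bp by have := le_trans (normr_ge0 _) (hBp 0%N 0%N); rewrite mulr1.
  have e0 n : 0 <= 2^-1 ^+ n :> K by rewrite exprn_ge0 // invr_ge0 ler0n.
  rewrite [leRHS]ger0_norm ?mulr_ge0 ?addr_ge0 // mulrDl.
  rewrite (le_trans (ler_normD _ _)) // lerD // (le_trans (hBp _ _)) //.
  rewrite exprS ler_wpM2l // ler_piMl //.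
  by rewrite -half_norm ltW // half_lt1.
have hG : G @ \oo --> (1 - z) *
     (qpoch_inf (z * q) q * qpoch_inf (z^-1 * q) q * qpoch_inf q q) * g2 z q.
  have hq b : (fun L => qpoch b q L.+1) @ \oo --> qpoch_inf b q.
    by rewrite (cvg_shiftS (qpoch b q)); exact: cvg_qpoch.
  apply: cvgnM; last by rewrite (cvg_shiftS (series _)); exact: cvg_g2_series.
  apply: cvgnM; first exact: cvg_cst.
  by apply: cvgnM; [apply: cvgnM|]; apply: hq.
have E L : series (rhs_term z q) L = G L -
    (\sum_(0 <= r < L) d1 r L + \sum_(0 <= r < L) d2 r L + d3 L).
  have hP : G L = qpoch q q L.+1 * (\sum_(0 <= r < L) z ^+ r * (mockP q L)`_(L + r)
      + \sum_(0 <= r < L) z^-1 ^+ r.+1 * (mockP q L)`_(L.-1 - r)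
      + (z ^+ L * (mockP q L)`_(L + L) + z ^+ L.+1 * (mockP q L)`_(L + L.+1))).
    have := mockP_split L; rewrite (mockP_g2 L) => /(mulfI (expf_neq0 L z0)) <-.
    by rewrite /G; ring.
  rewrite hP rhs_series !mulrDr !mulr_sumr /d1 /d2 /d3 /F.
  have s1 : \sum_(0 <= r < L) d1 r L =
     \sum_(0 <= r < L) qpoch q q L.+1 * (z ^+ r * (mockP q L)`_(L + r)) -
     \sum_(0 <= r < L) z ^+ r * (th r * ptheta_sum r (L - r).+1./2).
    by rewrite -sumrB; apply: eq_bigr => r _; rewrite /d1 /F; ring.
  have s2 : \sum_(0 <= r < L) d2 r L =
     \sum_(0 <= r < L) qpoch q q L.+1 * (z^-1 ^+ r.+1 * (mockP q L)`_(L.-1 - r)) -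
     \sum_(0 <= r < L) z^-1 ^+ r.+1 * (th r * (ptheta_sum r (L - r).+1./2 - 1)).
    by rewrite -sumrB; apply: eq_bigr => r _; rewrite /d2 /F; ring.
  by rewrite s1 s2; ring.
rewrite /has_sum (_ : series _ = (fun L => G L -
    (\sum_(0 <= r < L) d1 r L + \sum_(0 <= r < L) d2 r L + d3 L))); last exact/funext.
have h := cvgnD (cvgnD h1 h2) h3; rewrite !addr0 in h.
rewrite -[X in _ --> X]subr0; apply: cvgnD; first exact: hG.
by apply: cvgN; exact: h.
Unshelve. all: by end_near. Qed.

End HeckeSum.

End Mock.

End Analysis.

Unset Implicit Arguments.
Set Strict Implicit.

Theorem theorem1p2 (R : realType) (q z : R[i])
    (hq : 0 < `|q| < 1) (hz0 : z != 0) (hz : forall m : int, z != q ^ m) :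
  has_sum (rhs_term z q)
    ((1 - z) *
     (qpoch_inf (z * q) q * qpoch_inf (z^-1 * q) q * qpoch_inf q q) *
     g2 z q).
Proof.
have /andP[q0 q1] := hq; rewrite normr_gt0 in q0.
exact: (hecke_sum_g2 (@complex_geometrically_complete R) q0 q1 hz0 hz).
Qed.
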